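(* Let $P$ be a minuscule poset, i.e., a finite poset each of whose connected components is isomorphic to one of: (a) $\mathbf{a}\times\mathbf{b}$ for $a,b\ge1$; (b) the interval $[\varnothing,(b,b)]$ of Young's lattice for $b\ge1$; (c) $P_{a,1,1,a}$ for $a\ge1$; (d) $P(E_6)$ or $P(E_7)$. Then the minuscule lattice $J(P)$ is tCDE.
   Context: $\mathbf{a}$ is the chain with $a$ elements; $\times$ is the direct product. Young's lattice is the set of partitions ordered by $\nu\subseteq\lambda$ iff $\nu_i\le\lambda_i$ for all $i$. $P_{a,1,1,a}$ is the poset on $w_1,\ldots,w_a,x_1,y_1,z_1,\ldots,z_a$ with cover relations $w_1\lessdot\cdots\lessdot w_a$, $w_a\lessdot x_1$, $w_a\lessdot y_1$, $x_1\lessdot z_1$, $y_1\lessdot z_1$, $z_1\lessdot\cdots\lessdot z_a$. $P^{\mathrm{shift}}_{\delta_4}$ is the set of boxes $[i,j]$ with $1\le i\le j\le4$, ordered by $[i,j]\le[i',j']$ iff $i\le i'$, $j\le j'$; $P(E_6):=J(P^{\mathrm{shift}}_{\delta_4})$ (16 elements) and $P(E_7):=J(P(E_6))$ (27 elements). (These are the connected minuscule posets arising from minuscule representations of semisimple Lie algebras.) $J(Q)$ is the lattice of order ideals of $Q$ under inclusion; $\mathrm{ddeg}$ is the number of covered elements; $\mathrm{uni}$ is uniform. $\mathcal{T}^+_p(I)=1$ iff $p\notin I$ and $p$ minimal in $P\setminus I$; $\mathcal{T}^-_p(I)=1$ iff $p\in I$ and $p$ maximal in $I$. $\mu$ is toggle-symmetric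 if $\mathbb{E}(\mu;\mathcal{T}^+_p)=\mathbb{E}(\mu;\mathcal{T}^-_p)$ for all $p$; $J(P)$ is tCDE if $\mathbb{E}(\mu;\mathrm{ddeg})=\mathbb{E}(\mathrm{uni}_{J(P)};\mathrm{ddeg})$ for every toggle-symmetric $\mu$ on $J(P)$. *)

(* Defs.v *)
From HB Require Import structures.
From mathcomp Require Import all_boot all_order all_algebra.
Set Implicit Arguments. Unset Strict Implicit. Unset Printing Implicit Defensive.
Import Order.TTheory GRing.Theory Num.Theory.

Local Open Scope order_scope.

Definition Jset (U : finType) (A : {set U}) (le : rel U) : {set {set U}} :=
  [set I : {set U} | (I \subset A) &&
     [forall x in I, forall y in A, le y x ==> (y \in I)]].

Definition iso_to (U : finType) (A : {set U}) (le : rel U)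
    (d : Order.disp_t) (T : finPOrderType d) (C : {set T}) : Prop :=
  exists f : U -> T,
    [/\ {in A &, injective f}, f @: A = C &
        {in A &, forall x y, (f x <= f y) = le x y}].

Definition rect_A (a b : nat) : {set 'I_a * 'I_b} := setT.
Definition rect_le (a b : nat) : rel ('I_a * 'I_b) :=
  fun p q => ((p.1 <= q.1)%N && (p.2 <= q.2)%N).

(* (b) the interval [empty, (b,b)] of Young's lattice: partitions (l1, l2)
   with b >= l1 >= l2 >= 0, ordered by containment of partitions. *)
Definition young_A (b : nat) : {set 'I_b.+1 * 'I_b.+1} :=
  [set p : 'I_b.+1 * 'I_b.+1 | (p.2 <= p.1)%N].
Definition young_le (b : nat) : rel ('I_b.+1 * 'I_b.+1) :=
  fun p q => ((p.1 <= q.1)%N && (p.2 <= q.2)%N).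

(* (c) P_{a,1,1,a} on 2a+2 elements, indexed as
   w_1..w_a = 0..a-1, x_1 = a, y_1 = a+1, z_1..z_a = a+2..2a+1;
   the order is the reflexive-transitive closure of the cover relations. *)
Definition Paa_cov (a : nat) : rel 'I_(a.*2.+2) :=
  fun i' j' =>
    let i := nat_of_ord i' in let j := nat_of_ord j' in
    [|| (j == i.+1) && (i.+1 < a)%N,
        (i == a.-1) && ((j == a) || (j == a.+1)),
        ((i == a) || (i == a.+1)) && (j == a.+2)
      | (a.+2 <= i)%N && (j == i.+1)].
Definition Paa_A (a : nat) : {set 'I_(a.*2.+2)} := setT.
Definition Paa_le (a : nat) : rel 'I_(a.*2.+2) := connect (@Paa_cov a).

(* (d) P^shift_{delta_4}: boxes [i,j], 1 <= i <= j <= 4 (indexed from 0). *)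
Definition shift_A : {set 'I_4 * 'I_4} := [set p : 'I_4 * 'I_4 | (p.1 <= p.2)%N].
Definition shift_le : rel ('I_4 * 'I_4) :=
  fun p q => ((p.1 <= q.1)%N && (p.2 <= q.2)%N).

Definition E6_A : {set {set 'I_4 * 'I_4}} := Jset shift_A shift_le.
Definition E6_le : rel {set 'I_4 * 'I_4} := fun I J => I \subset J.

Definition E7_A : {set {set {set 'I_4 * 'I_4}}} := Jset E6_A E6_le.
Definition E7_le : rel {set {set 'I_4 * 'I_4}} := fun I J => I \subset J.

Section Poset.
Context {d : Order.disp_t} (P : finPOrderType d).

Definition component (x : P) : {set P} :=
  [set y | connect (fun u v : P => u >=< v) x y].

Definition minuscule : Prop :=
  forall x : P, let C := component x in
     (exists a b, [/\ (1 <= a)%N, (1 <= b)%N & iso_to (@rect_A a b) (@rect_le a b) C])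
  \/ (exists b, (1 <= b)%N /\ iso_to (@young_A b) (@young_le b) C)
  \/ (exists a, (1 <= a)%N /\ iso_to (@Paa_A a) (@Paa_le a) C)
  \/ iso_to E6_A E6_le C
  \/ iso_to E7_A E7_le C.

Definition is_ideal (I : {set P}) : bool :=
  [forall x in I, forall y : P, (y <= x) ==> (y \in I)].

Definition Jcovers (I' I : {set P}) : bool :=
  [&& is_ideal I', is_ideal I, I' \proper I &
      [forall K : {set P}, is_ideal K ==> ~~ ((I' \proper K) && (K \proper I))]].

Definition ddeg (I : {set P}) : nat := #|[set I' | Jcovers I' I]|.

Definition Tplus (p : P) (I : {set P}) : bool :=
  (p \notin I) && [forall q : P, (q \notin I) ==> ~~ (q < p)].
Definition Tminus (p : P) (I : {set P}) : bool :=
  (p \in I) && [forall q : P, (q \in I) ==> ~~ (p < q)].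

Local Open Scope ring_scope.
Variable R : realFieldType.

Definition distribution (mu : {set P} -> R) : Prop :=
  [/\ forall I, 0 <= mu I,
      forall I, ~~ is_ideal I -> mu I = 0
    & \sum_(I : {set P} | is_ideal I) mu I = 1].

Definition expect (mu : {set P} -> R) (f : {set P} -> R) : R :=
  \sum_(I : {set P} | is_ideal I) mu I * f I.

Definition uni : {set P} -> R :=
  fun I => if is_ideal I then (#|[set J : {set P} | is_ideal J]|%:R)^-1 else 0.

Definition toggle_symmetric (mu : {set P} -> R) : Prop :=
  distribution mu /\
  forall p : P, expect mu (fun I => (Tplus p I)%:R) = expect mu (fun I => (Tminus p I)%:R).

Definition tCDE : Prop :=
  forall mu : {set P} -> R, toggle_symmetric mu ->
    expect mu (fun I => (ddeg I)%:R) = expect uni (fun I => (ddeg I)%:R).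

End Poset.

(* Main.v *)
Require Import Defs.
From HB Require Import structures.
From mathcomp Require Import all_boot all_order all_algebra.
From mathcomp Require Import zify ring.
Set Implicit Arguments. Unset Strict Implicit. Unset Printing Implicit Defensive.
Import Order.TTheory GRing.Theory Num.Theory.

(** Let [T+_p], [T-_p] be the toggleability statistics. The down-degree of an ideal
    is the sum of its [T-_p], so it suffices to find coefficients [c_p] for which
    [sum_p (c_p T+_p + (1 - c_p) T-_p)] is constant on ideals: a toggle-symmetric
    distribution does not distinguish [T+_p] from [T-_p], hence gives [ddeg] that
    constant as expectation, and the uniform distribution is toggle-symmetric.
    As [T+_p] and [T-_p] only see the connected component of [p], such coefficients
    are needed for each connected minuscule poset only. They come from the minuscule
    weights: if an ideal [I] corresponds to the weight [lambda], then [T+ - T-]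
    summed over the elements of colour [i] is [<lambda, alpha_i>], and expanding
    the constant norm [(lambda, lambda)] along the fundamental weights gives
    [c_p = (lambda_0, omega_i) - r], where [lambda_0] is the weight of the empty
    ideal, [p] has colour [i] and [r] is the number of elements of colour [i]
    strictly below [p]. The constant is [(lambda, lambda)]. *)

Definition tplus (U : finType) (A : {set U}) (le : rel U) (u : U) (S : {set U}) :=
  (u \notin S) && [forall v in A, (v \notin S) ==> le v u ==> (v == u)].

Definition tminus (U : finType) (le : rel U) (u : U) (S : {set U}) :=
  (u \in S) && [forall v in S, le u v ==> (v == u)].

Local Open Scope ring_scope.
(** The weights [c u] and [1 - c u] add up to 1, so exchanging [tplus] for [tminus] in expectation
    leaves exactly the sum of the [tminus]. The carrier is a set with a relation, the shape in which
    [iso_to] presents a component. *)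
Definition toggle_certified (R : realFieldType) (U : finType) (A : {set U})
    (le : rel U) : Prop :=
  exists (c : U -> R) (k : R), forall S, S \in Jset A le ->
    \sum_(u in A) (c u * (tplus A le u S)%:R + (1 - c u) * (tminus le u S)%:R) = k.

(** * Order ideals, their maximal elements and the down-degree *)

Section Toggles.
Context {d : Order.disp_t} (P : finPOrderType d).
Implicit Types (I J : {set P}) (p q : P).

Lemma is_idealP I :
  reflect (forall x y, x \in I -> (y <= x)%O -> y \in I) (is_ideal I).
Proof.
apply: (iffP forall_inP) => [H x y xI yx | H x xI].
  by move/forallP/(_ y)/implyP: (H x xI); apply.
by apply/forallP => y; apply/implyP; apply: H.
Qed.

Lemma TplusP p I :
  reflect (p \notin I /\ forall q, (q < p)%O -> q \in I) (Tplus p I).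
Proof.
apply: (iffP andP) => -[pI H]; split => //.
  by move=> q qp; apply/negPn/negP => qI; move/forallP/(_ q): H; rewrite qI qp.
apply/forallP => q; apply/implyP => qI; apply/negP => /H; exact/negP.
Qed.

Lemma TminusP p I :
  reflect (p \in I /\ forall q, (p < q)%O -> q \notin I) (Tminus p I).
Proof.
apply: (iffP andP) => -[pI H]; split => //.
  by move=> q qp; apply/negP => qI; move/forallP/(_ q): H; rewrite qI qp.
apply/forallP => q; apply/implyP => qI; apply/negP => /H; by rewrite qI.
Qed.

Lemma is_ideal_setD1 p I : is_ideal I -> Tminus p I -> is_ideal (I :\ p).
Proof.
move=> /is_idealP idI /TminusP[pI maxp]; apply/is_idealP => x y.
rewrite !in_setD1 => /andP[xp xI] yx; rewrite (idI _ _ xI yx) andbT.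
apply/eqP => yp; subst y; move: (maxp x); rewrite lt_neqAle eq_sym xp yx xI.
by move/(_ isT).
Qed.

Lemma is_ideal_setU1 p I : is_ideal I -> Tplus p I -> is_ideal (p |: I).
Proof.
move=> /is_idealP idI /TplusP[pI minp]; apply/is_idealP => x y.
rewrite !in_setU1 => /orP[/eqP-> | xI] yx; last by rewrite (idI _ _ xI yx) orbT.
by move: yx; rewrite le_eqVlt => /orP[-> //|/minp ->]; rewrite orbT.
Qed.

Lemma Tminus_setU1 p I : is_ideal I -> Tplus p I -> Tminus p (p |: I).
Proof.
move=> /is_idealP idI /TplusP[pI minp]; apply/TminusP; rewrite setU11; split=> //.
move=> q pq; rewrite in_setU1 negb_or (gt_eqF pq) /=.
by apply/negP => qI; move: pI; rewrite (idI _ _ qI (ltW pq)).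
Qed.

Lemma Tplus_setD1 p I : is_ideal I -> Tminus p I -> Tplus p (I :\ p).
Proof.
move=> /is_idealP idI /TminusP[pI maxp]; apply/TplusP; rewrite setD11; split=> //.
by move=> q qp; rewrite in_setD1 (lt_eqF qp) (idI _ _ pI (ltW qp)).
Qed.

(** Among the elements of [I] above [q], one with the fewest elements of [I] above it is maximal: a
    strictly larger one would have fewer. *)
Lemma Tminus_above q I : q \in I -> exists2 p, (q <= p)%O & Tminus p I.
Proof.
move=> qI; pose M x := #|[set y in I | (x <= y)%O]|.
have qq : (q \in I) && (q <= q)%O by rewrite qI lexx.
have [p /andP[pI qp] minp] := arg_minnP M (qq : [pred x in I | (q <= x)%O] q).
exists p => //; apply/TminusP; split=> // x px; apply/negP => xI.
have := minp x; rewrite /= xI (le_trans qp (ltW px)) => /(_ isT).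
rewrite leqNgt => /negP; apply; apply/proper_card/properP; split.
  by apply/subsetP => y; rewrite !inE => /andP[-> /(le_trans (ltW px)) ->].
by exists p; rewrite !inE pI ?lexx //= lt_geF.
Qed.

(** An ideal strictly inside [I] misses some [q] in [I], hence also a maximal element [p] above [q],
    so it lies inside the ideal [I :\ p]; covering forces equality. *)
Lemma JcoversE I : is_ideal I ->
  [set I' | Jcovers I' I] = [set I :\ p | p in [set p | Tminus p I]].
Proof.
move=> idI; apply/setP => I'; rewrite inE; apply/idP/imsetP.
  case/and4P => idI' _ /properP[sII' [q qI qI']] /forallP cov.
  have [p qp maxp] := Tminus_above qI; exists p; rewrite ?inE //.
  have pI' : p \notin I'.
    by apply: contra qI' => pI'; move/is_idealP: idI' => /(_ p q pI' qp).
  have sub : I' \subset I :\ p.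
    by apply/subsetP => x xI'; rewrite in_setD1 (subsetP sII') // andbT;
       apply: contraNneq pI' => <-.
  have := cov (I :\ p); rewrite is_ideal_setD1 // properD1 /=; last by case/andP: maxp.
  by rewrite andbT properE sub /= negbK => sub'; apply/eqP; rewrite eqEsubset sub.
case=> p; rewrite inE => maxp ->; rewrite /Jcovers is_ideal_setD1 // idI.
have pI : p \in I by case/andP: maxp.
rewrite properD1 //=; apply/forallP => K; apply/implyP => _; apply/negP.
(* Nothing fits strictly between two nested sets of consecutive cardinalities. *)
case/andP => /proper_card h1 /proper_card h2; move: h1 h2.
by rewrite (cardsD1 p I) pI; lia.
Qed.

Lemma ddeg_sum I : is_ideal I -> ddeg I = (\sum_p Tminus p I)%N.
Proof.
move=> idI; rewrite /ddeg JcoversE // card_in_imset.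
  by rewrite -sum1_card big_mkcond /=; apply: eq_bigr => p _; rewrite inE; case: Tminus.
move=> p q; rewrite !inE => /andP[pI _] /andP[qI _] /setP/(_ p).
by rewrite !in_setD1 eqxx pI andbT; case: eqP.
Qed.

(** * Expectations and the uniform distribution *)

Variable R : realFieldType.

Lemma expectD (mu f g : {set P} -> R) :
  expect mu (fun I => f I + g I) = expect mu f + expect mu g.
Proof. by rewrite -big_split; apply: eq_bigr => I _; rewrite mulrDr. Qed.

Lemma expectZ (mu : {set P} -> R) c (f : {set P} -> R) :
  expect mu (fun I => c * f I) = c * expect mu f.
Proof. by rewrite mulr_sumr; apply: eq_bigr => I _; rewrite mulrCA. Qed.

Lemma expect_sum (T : finType) (A : pred T) (mu : {set P} -> R)
    (f : T -> {set P} -> R) :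
  expect mu (fun I => \sum_(t in A) f t I) = \sum_(t in A) expect mu (f t).
Proof.
rewrite exchange_big; apply: eq_bigr => I _; exact: mulr_sumr.
Qed.

Lemma eq_expect (mu f g : {set P} -> R) :
  (forall I, is_ideal I -> f I = g I) -> expect mu f = expect mu g.
Proof. by move=> fg; apply: eq_bigr => I /fg ->. Qed.

Lemma expect_cst (mu : {set P} -> R) k :
  distribution mu -> expect mu (fun=> k) = k.
Proof. by case=> _ _ mu1; rewrite /expect -mulr_suml mu1 mul1r. Qed.

(** Adding [p] and removing [p] are inverse bijections between the ideals where [p] is addable and
    those where it is removable, and all ideals have the same mass. *)
Lemma uni_toggle_symmetric : toggle_symmetric (@uni _ P R).
Proof.
pose n := #|[set J : {set P} | is_ideal J]|.
have n0 : (0 < n)%N.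
  apply/card_gt0P; exists set0; rewrite inE; apply/is_idealP => x y.
  by rewrite inE.
split.
  split=> [I|I /negbTE|]; rewrite /uni.
  - by case: ifP => // _; rewrite invr_ge0 ler0n.
  - by move=> ->.
  - under eq_bigr => I -> do [].
    rewrite -/n sumr_const (_ : #|_| = n); last by apply: eq_card => I; rewrite !inE.
    by rewrite -[LHS]mulr_natl divff // pnatr_eq0 -lt0n.
move=> p; rewrite /expect /uni.
transitivity (\sum_(I : {set P} | is_ideal I && Tplus p I) (n%:R^-1 : R)).
  rewrite [RHS]big_mkcondr; apply: eq_bigr => I ->.
  by case: Tplus; rewrite ?mulr1 ?mulr0.
transitivity (\sum_(I : {set P} | is_ideal I && Tminus p I) (n%:R^-1 : R)); last first.
  rewrite [LHS]big_mkcondr; apply: eq_bigr => I ->.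
  by case: Tminus; rewrite ?mulr1 ?mulr0.
rewrite [RHS](reindex_onto (fun I => p |: I) (fun I => I :\ p)) /=; last first.
  by move=> I /andP[_ /andP[pI _]]; rewrite setD1K.
apply: eq_bigl => I; apply/idP/idP.
  move=> /andP[idI tI]; rewrite is_ideal_setU1 // Tminus_setU1 //=.
  by rewrite setU1K //; case/andP: tI.
case/andP => /andP[idI tI] /eqP <-.
by rewrite is_ideal_setD1 // Tplus_setD1.
Qed.

(** * Reduction to connected components *)

Lemma component_refl p : p \in component p.
Proof. by rewrite inE connect0. Qed.

Lemma component_eq p q : (component p == component q) = (p \in component q).
Proof.
have sym : connect_sym (fun u v : P => (u >=< v)%O).
  apply: sym_connect_sym => u v; exact: comparable_sym.
apply/eqP/idP => [<-|]; first exact: component_refl.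
rewrite inE => qp; apply/setP => x; rewrite !inE.
by apply/idP/idP; apply: connect_trans => //; rewrite sym.
Qed.

Lemma component_comparable p q r :
  p \in component r -> (p >=< q)%O -> q \in component r.
Proof. by rewrite !inE => rp pq; apply: connect_trans rp (connect1 _). Qed.

(** Everything comparable with [f u] lies in the component, so toggleability at [f u] depends only
    on the trace of the ideal there, and the certificate applies to its preimage [S]. *)
Lemma expect_Tminus_component (U : finType) (A : {set U}) (le : rel U) (x : P) :
  toggle_certified R A le -> iso_to A le (component x) ->
  exists k, forall mu : {set P} -> R, toggle_symmetric mu ->
    expect mu (fun I => \sum_(p in component x) (Tminus p I)%:R) = k.
Proof.
move=> [c [k cert]] [f [finj fA fle]]; exists k => mu [mud mut].
have fC u : u \in A -> f u \in component x by move=> uA; rewrite -fA imset_f.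
have key I : is_ideal I -> \sum_(u in A) (c u * (Tplus (f u) I)%:R
    + (1 - c u) * (Tminus (f u) I)%:R) = k.
  move=> /is_idealP idI; pose S := [set u in A | f u \in I].
  rewrite -(cert S); last first.
    rewrite inE; apply/andP; split.
      by apply/subsetP => u; rewrite inE => /andP[].
    apply/forall_inP => u; rewrite inE => /andP[uA uI]; apply/forall_inP => v vA.
    by apply/implyP => vu; rewrite inE vA (idI _ _ uI) // fle.
  apply: eq_bigr => u uA; congr (_ * _%:R + _ * _%:R); congr nat_of_bool.
    apply/TplusP/andP => -[h1 h2]; split.
    - by rewrite inE uA.
    - apply/forall_inP => v vA; rewrite inE vA /=; apply/implyP => vI.
      apply/implyP; rewrite -fle // le_eqVlt => /orP[/eqP/finj->//|].
      by move=> /h2; rewrite (negbTE vI).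
    - by move: h1; rewrite inE uA.
    - move=> q qu; have : q \in component x.
        by apply: component_comparable (fC _ uA) _; rewrite comparable_sym lt_comparable.
      rewrite -fA => /imsetP[v vA qv]; subst q.
      apply/negPn/negP => vI; move/forall_inP/(_ v vA): h2.
      rewrite inE vA vI -fle // (ltW qu) /= => /eqP vu.
      by move: qu; rewrite vu ltxx.
  apply/TminusP/andP => -[h1 h2]; split.
  - by rewrite inE uA.
  - apply/forall_inP => v; rewrite inE => /andP[vA vI].
    apply/implyP; rewrite -fle // le_eqVlt => /orP[/eqP/finj->//|].
    by move=> /h2; rewrite vI.
  - by move: h1; rewrite inE uA.
  - move=> q uq; have : q \in component x.
      by apply: component_comparable (fC _ uA) _; rewrite lt_comparable.
    rewrite -fA => /imsetP[v vA qv]; subst q.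
    apply/negP => vI; move/forall_inP/(_ v): h2.
    rewrite inE vA vI -fle // (ltW uq) /= => /(_ isT) /eqP vu.
    by move: uq; rewrite vu ltxx.
transitivity (expect mu (fun I => \sum_(u in A) (Tminus (f u) I)%:R)).
  by apply: eq_expect => I _; rewrite -fA big_imset.
(* [k] is the expectation of the certified sum; [mut] then turns each [Tplus] into [Tminus], whose
   two coefficients add up to 1. *)
rewrite -[RHS](expect_cst k mud) -(eq_expect _ key) !expect_sum.
apply: eq_bigr => u _; rewrite expectD !expectZ mut; ring.
Qed.

(** The down-degree splits over components, and the constants found for an arbitrary
    toggle-symmetric distribution are also those of [uni], which is one of them. *)
Lemma tCDE_of_components :
  (forall x : P, exists k, forall mu : {set P} -> R, toggle_symmetric mu ->
    expect mu (fun I => \sum_(p in component x) (Tminus p I)%:R) = k) ->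
  tCDE P R.
Proof.
move=> H mu tmu; pose comps := [set component x | x in P].
have split nu : expect nu (fun I => (ddeg I)%:R) =
    \sum_(C in comps) expect nu (fun I => \sum_(p in C) (Tminus p I)%:R : R).
  rewrite -expect_sum; apply: eq_expect => I idI.
  rewrite ddeg_sum // natr_sum (partition_big (@component _ P) (mem comps)) /=; last first.
    by move=> p _; apply: imset_f.
  apply: eq_bigr => C /imsetP[x _ ->]; apply: eq_bigl => p; exact: component_eq.
rewrite !split; apply: eq_bigr => C /imsetP[x _ ->].
by have [k hk] := H x; rewrite !hk //; exact: uni_toggle_symmetric.
Qed.

End Toggles.

(** * Rectangles, shifted staircases and [P_{a,1,1,a}] *)

(** The first failure of [p], or [b] when there is none below [b]. *)
Definition segment_length (p : pred nat) (b : nat) := find (predC p) (iota 0 b).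

Lemma segment_lengthP (p : pred nat) (b : nat) :
  (forall j, p j -> (j < b)%N) ->
  (forall i j, (i <= j)%N -> p j -> p i) ->
  forall j, p j = (j < segment_length p b)%N.
Proof.
move=> pb pd j; rewrite /segment_length; apply/idP/idP => [pj | jl].
  rewrite ltnNge; apply/negP => lj.
  have lb : (find (predC p) (iota 0 b) < b)%N by apply: leq_ltn_trans lj (pb _ pj).
  have : has (predC p) (iota 0 b) by rewrite has_find size_iota.
  by move/(nth_find 0%N); rewrite nth_iota //= add0n (pd _ _ lj pj).
have jb : (j < b)%N by apply: leq_trans jl _; rewrite -[X in (_ <= X)%N](size_iota 0) find_size.
by have := before_find 0%N jl; rewrite nth_iota // add0n /= => /negbFE.
Qed.

Lemma segment_length_le (p : pred nat) (b : nat) : (segment_length p b <= b)%N.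
Proof. by rewrite -[X in (_ <= X)%N](size_iota 0) find_size. Qed.

(** Evaluates one row of a diagram, which has at most one addable and one removable box: [B] tells
    whether the box exists, and only then must its position [l] be in range. *)
Lemma sum_ord_pick (R : pzRingType) (n l : nat) (B : bool) (f : nat -> R) :
  (B -> (l < n)%N) ->
  \sum_(j < n) f j * ((nat_of_ord j == l) && B)%:R = f l * B%:R.
Proof.
case: B => [/(_ isT) ln | _]; last first.
  by rewrite mulr0 big1 // => j _; rewrite andbF mulr0.
rewrite (bigD1 (Ordinal ln)) //= eqxx big1 ?addr0 // => j jl.
by rewrite (_ : _ == l = false) ?mulr0 //; apply: contraNF jl => /eqP jl; apply/eqP/val_inj.
Qed.

Lemma sum_ord_pick_cond (R : pzRingType) (n l : nat) (B : bool) (D : pred nat) (f : nat -> R) :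
  (B -> (l < n)%N && D l) ->
  \sum_(j < n | D j) f j * ((nat_of_ord j == l) && B)%:R = f l * B%:R.
Proof.
move=> h; rewrite -(@sum_ord_pick _ n l B f); last by case/h/andP.
rewrite big_mkcond; apply: eq_bigr => j _; case: ifP => // Dj.
case: B h => [/(_ isT) /andP[_ Dl]|_]; last by rewrite andbF mulr0.
case: eqP => [jl|_]; last by rewrite mulr0.
by rewrite -jl Dj in Dl.
Qed.

(** The coefficients are those of the weight omega_a in type A_{a+b-1}, of norm ab/(a+b). An ideal
    is encoded by its row lengths, and the sum telescopes over the rows. *)
Lemma rect_certified (R : realFieldType) (a b : nat) : (1 <= a)%N ->
  toggle_certified R (@rect_A a b) (@rect_le a b).
Proof.
move=> a1; have ab0 : (a%:R + b%:R : R) != 0 by rewrite -natrD pnatr_eq0; lia.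
pose t : R := a%:R / (a%:R + b%:R).
pose c (i j : nat) : R := (a%:R * b%:R - b%:R * i%:R - a%:R * j%:R) / (a%:R + b%:R).
exists (fun u : 'I_a * 'I_b => c u.1 u.2), (t * b%:R) => S.
rewrite inE => /andP[_ /forall_inP Sd].
have {}Sd (u v : 'I_a * 'I_b) : u \in S -> (v.1 <= u.1)%N -> (v.2 <= u.2)%N -> v \in S.
  move=> uS h1 h2; move/forall_inP/(_ v): (Sd _ uS); rewrite inE /rect_le h1 h2.
  by move/(_ isT).
pose s (i j : nat) := [exists u in S, (u.1 == i :> nat) && (u.2 == j :> nat)].
have sE (i : 'I_a) (j : 'I_b) : s i j = ((i, j) \in S).
  apply/exists_inP/idP => [[[i' j'] uS /= /andP[/eqP/val_inj <- /eqP/val_inj <-]] //|].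
  by move=> uS; exists (i, j) => //=; rewrite !eqxx.
have sb i j : s i j -> (i < a)%N /\ (j < b)%N.
  by case/exists_inP => u _ /andP[/eqP<- /eqP<-].
have sd i j i' j' : s i j -> (i' <= i)%N -> (j' <= j)%N -> s i' j'.
  move=> sij ii jj; have [ia jb] := sb _ _ sij.
  have ia' : (i' < a)%N by apply: leq_ltn_trans ia.
  have jb' : (j' < b)%N by apply: leq_ltn_trans jb.
  move: sij; rewrite (sE (Ordinal ia) (Ordinal jb)) (sE (Ordinal ia') (Ordinal jb')).
  by move=> h; apply: Sd h _ _.
(* [L i.+1] is the length of row [i]. The value [L 0 = b] stands for a full row before row 0, so
   that row 0 obeys the common rule for addable boxes. *)
have [L [L0 LS]] : exists L : nat -> nat,
    L 0%N = b /\ forall i, L i.+1 = segment_length (s i) b.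
  by exists (fun k => if k is i.+1 then segment_length (s i) b else b).
have sL i j : s i j = (j < L i.+1)%N.
  rewrite LS; apply: segment_lengthP => [j' /sb[]// | j1 j2 le12 h]; exact: sd h _ _.
have Lb k : (L k <= b)%N by case: k => [|k]; rewrite ?L0 // LS; exact: segment_length_le.
have Ldec k : (L k.+1 <= L k)%N.
  case: k => [|k]; first by rewrite L0; exact: Lb.
  rewrite leqNgt; apply/negP => h; have := sL k.+1 (L k.+1); rewrite h => h'.
  by have := sd _ _ k (L k.+1) h' (leqnSn _) (leqnn _); rewrite sL ltnn.
(* An empty row after the last one plays the same part for removable boxes. *)
have La : L a.+1 = 0%N.
  by apply/eqP; rewrite -leqn0 leqNgt; apply/negP; rewrite -sL => /sb[]; rewrite ltnn.
have tpE (i : 'I_a) (j : 'I_b) : tplus (@rect_A a b) (@rect_le a b) (i, j) S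
    = (nat_of_ord j == L i.+1) && (L i.+1 < L i)%N.
  rewrite /tplus -sE sL -leqNgt; apply/andP/andP => -[h1 h2].
    have jL : nat_of_ord j = L i.+1.
      apply/eqP; rewrite eqn_leq h1 andbT leqNgt; apply/negP => h3.
      have jb : (L i.+1 < b)%N by apply: ltn_trans h3 _.
      move/forall_inP/(_ (i, Ordinal jb)): h2; rewrite inE -sE sL ltnn /rect_le /=.
      rewrite leqnn (ltnW h3) => /(_ isT)/eqP[jE]; move: h3; rewrite -jE /=; lia.
    split; first exact/eqP.
    rewrite -jL; case: (posnP i) => [->|i0]; first by rewrite L0; exact: ltn_ord.
    have ia : (i.-1 < a)%N by have := ltn_ord i; lia.
    rewrite ltnNge; apply/negP => h3; move/forall_inP/(_ (Ordinal ia, j)): h2.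
    rewrite inE -sE sL -leqNgt /= prednK // h3 /rect_le /= leqnn leq_pred.
    by move/(_ isT)/eqP => [] /(congr1 (@nat_of_ord _)) /=; lia.
  split; first by rewrite (eqP h1).
  apply/forall_inP => -[i' j'] _; rewrite -sE sL -leqNgt /rect_le /=.
  apply/implyP => h3; apply/implyP => /andP[h4 h5].
  have [ii|ii] := eqVneq (nat_of_ord i') (nat_of_ord i).
    apply/eqP; congr (_, _); apply/val_inj => //=.
    by move/eqP: h1 => h1; rewrite ii in h3; lia.
  have : (i' < i)%N by lia.
  case: (nat_of_ord i) h1 h2 => [//|k] /eqP h1 h2; rewrite ltnS => h6.
  have skj : s k j by rewrite sL h1.
  by have := sd _ _ _ _ skj h6 h5; rewrite sL; lia.
(* For an empty row the predecessor defaults to 0, but the strict inequality is then false. *)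
have tmE (i : 'I_a) (j : 'I_b) : tminus (@rect_le a b) (i, j) S
    = (nat_of_ord j == (L i.+1).-1) && (L i.+2 < L i.+1)%N.
  rewrite /tminus -sE sL; apply/andP/andP => -[h1 h2].
    have jL : j.+1 = L i.+1 :> nat.
      apply/eqP; rewrite eqn_leq h1 /= leqNgt; apply/negP => h3.
      have jb : (j.+1 < b)%N by apply: leq_trans h3 (Lb i.+1).
      move/forall_inP/(_ (i, Ordinal jb)): h2; rewrite -sE sL h3 /rect_le /=.
      rewrite leqnn leqnSn => /(_ isT)/eqP[] /(congr1 (@nat_of_ord _)) /=; lia.
    split; first by rewrite -jL.
    rewrite -jL ltnNge; apply/negP => h3.
    have /sb[/= ia _] : s i.+1 j by rewrite sL.
    move/forall_inP/(_ (Ordinal ia, j)): h2; rewrite -sE sL h3 /rect_le /= leqnSn leqnn.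
    by move/(_ isT)/eqP => [] /(congr1 (@nat_of_ord _)) /=; lia.
  split; first by lia.
  apply/forall_inP => -[i' j']; rewrite -sE => h3; apply/implyP; rewrite /rect_le /=.
  move=> /andP[h4 h5].
  have [ii|ii] := eqVneq (nat_of_ord i') (nat_of_ord i).
    apply/eqP; congr (_, _); apply/val_inj => //=.
    by move: h3; rewrite sL ii; lia.
  have h6 : (i < i')%N by lia.
  by have := sd _ _ _ _ h3 h6 h5; rewrite sL; lia.
(* [Q] telescopes because [1 - c i j = - c i.+1 j.+1]. *)
pose Q k : R := c k (L k) * (L k.+1 < L k)%N%:R.
(* Along row [n], [c] drops by [t] per column, so replacing column [L n.+1] by [L n] costs [t] times
   the difference of the lengths. *)
have rowE n : (n < a)%N -> c n (L n.+1) * (L n.+1 < L n)%N%:R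
    + (1 - c n (L n.+1).-1) * (L n.+2 < L n.+1)%N%:R
    = t * ((L n)%:R - (L n.+1)%:R) + Q n - Q n.+1.
  move=> na; rewrite /Q; congr (_ + _).
    have := Ldec n; rewrite leq_eqVlt => /orP[/eqP->|->]; first by rewrite ltnn mulr0n; ring.
    by rewrite /c /t !mulr1n; field.
  case h: (L n.+2 < L n.+1)%N; last by rewrite mulr0n; ring.
  case: (L n.+1) h => // l _; by rewrite /c /= -!natr1; field.
have total n : (n <= a)%N -> \sum_(i < n) (c i (L i.+1) * (L i.+1 < L i)%N%:R
    + (1 - c i (L i.+1).-1) * (L i.+2 < L i.+1)%N%:R)
    = t * (b%:R - (L n)%:R) + Q 0%N - Q n.
  elim: n => [|n IH] na; first by rewrite big_ord0 L0; ring.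
  by rewrite big_ord_recr /= IH ?rowE //; [ring | lia].
transitivity (\sum_(i < a) (c i (L i.+1) * (L i.+1 < L i)%N%:R
    + (1 - c i (L i.+1).-1) * (L i.+2 < L i.+1)%N%:R)).
  rewrite (eq_bigl xpredT) => [|u]; last by rewrite inE.
  pose g (i : 'I_a) (j : 'I_b) :=
    c i j * (tplus (@rect_A a b) (@rect_le a b) (i, j) S)%:R
    + (1 - c i j) * (tminus (@rect_le a b) (i, j) S)%:R.
  rewrite (eq_bigr (fun u => g u.1 u.2)) => [|[i j] _ //]; rewrite -(pair_bigA _ g).
  apply: eq_bigr => i _; rewrite big_split /=; congr (_ + _).
    under eq_bigr => j _ do rewrite tpE.
    by apply: sum_ord_pick => h; have := Lb i; lia.
  under eq_bigr => j _ do rewrite tmE.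
  apply: (@sum_ord_pick _ _ _ _ (fun j => 1 - c i j)) => h.
  by have := Lb i.+1; lia.
(* At the ends, [c 0 b = 0] kills [Q 0], and [Q a] equals [- t] times [L a], which cancels the
   remaining length. *)
rewrite total // /Q La L0 /c /t.
have [->|l0] := posnP (L a); first by field.
by rewrite /=; field.
Qed.

(** The coefficients are those of a spin weight in type D_{b+2}, of norm (b+2)/4; the two spin nodes
    colour the diagonal boxes alternately, whence the separate value at [m = 0]. Ideals are strict
    partitions. *)
Lemma young_certified (R : realFieldType) (b : nat) :
  toggle_certified R (@young_A b) (@young_le b).
Proof.
(* [c j m] is the coefficient of the box with second coordinate [j] and first
   coordinate [j + m]. *)
pose c (j m : nat) : R := if m == 0%N then (b%:R + 2 - 2 * j%:R) / 4
                          else (b%:R + 1 - 2 * j%:R - m%:R) / 2.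
exists (fun u : 'I_b.+1 * 'I_b.+1 => c u.2 (u.1 - u.2)%N), ((b%:R + 2) / 4) => S.
rewrite inE => /andP[/subsetP SA /forall_inP Sd].
have {}SA (u : 'I_b.+1 * 'I_b.+1) : u \in S -> (u.2 <= u.1)%N.
  by move=> /SA; rewrite inE.
have {}Sd (u v : 'I_b.+1 * 'I_b.+1) : u \in S -> (v.2 <= v.1)%N ->
    (v.1 <= u.1)%N -> (v.2 <= u.2)%N -> v \in S.
  move=> uS vA h1 h2; move/forall_inP/(_ v): (Sd _ uS); rewrite inE /young_le vA h1 h2.
  by move/(_ isT).
pose s (i j : nat) := [exists u in S, (u.1 == i :> nat) && (u.2 == j :> nat)].
have sE (i j : 'I_b.+1) : s i j = ((i, j) \in S).
  apply/exists_inP/idP => [[[i' j'] uS /= /andP[/eqP/val_inj <- /eqP/val_inj <-]] //|].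
  by move=> uS; exists (i, j) => //=; rewrite !eqxx.
have sb i j : s i j -> (j <= i)%N /\ (i < b.+1)%N.
  by case/exists_inP => u uS /andP[/eqP<- /eqP<-]; split; [exact: SA | exact: ltn_ord].
have sd i j i' j' : s i j -> (j' <= i')%N -> (i' <= i)%N -> (j' <= j)%N -> s i' j'.
  move=> sij ji ii jj; have [jlei ib] := sb _ _ sij.
  have jb : (j < b.+1)%N by apply: leq_ltn_trans ib.
  have ib' : (i' < b.+1)%N by apply: leq_ltn_trans ib.
  have jb' : (j' < b.+1)%N by apply: leq_ltn_trans jb.
  move: sij; rewrite (sE (Ordinal ib) (Ordinal jb)) (sE (Ordinal ib') (Ordinal jb')).
  by move=> h; apply: Sd h _ _ _.
(* [L j.+1] counts the boxes with second coordinate [j], whose first coordinates start at [j]. With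
   [L 0 = b + 2], the inequality [(L 1).+1 < L 0] says that row 0 is not full. *)
have [L [L0 LS]] : exists L : nat -> nat,
    L 0%N = b.+2 /\ forall j, L j.+1 = segment_length (fun m => s (j + m)%N j) b.+1.
  by exists (fun k => if k is j.+1 then segment_length (fun m => s (j + m)%N j) b.+1 else b.+2).
have sL j m : s (j + m)%N j = (m < L j.+1)%N.
  rewrite LS; apply: (segment_lengthP (p := fun m => s (j + m)%N j)).
    by move=> m' /sb[]; lia.
  by move=> m1 m2 le12 h; apply: sd h _ _ _; lia.
have sL' i j : (j <= i)%N -> s i j = (i - j < L j.+1)%N by move=> ji; rewrite -sL subnKC.
have Lb j : (L j.+1 + j <= b.+1)%N || (L j.+1 == 0)%N.
  case l0: (L j.+1) => [|l]; first by rewrite orbT.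
  by have : s (j + l)%N j; [rewrite sL l0 | move/sb => [_]; lia].
have Ldec j : (L j.+1 < L j)%N || (L j.+1 == 0)%N.
  case: j => [|j]; first by have := Lb 0%N; rewrite L0; lia.
  case l0: (L j.+2) => [|l]; first by rewrite orbT.
  have h : s (j.+1 + l)%N j.+1 by rewrite sL l0.
  by have := sd _ _ (j + l.+1)%N j h; rewrite sL orbF; apply; lia.
have tpE (i j : 'I_b.+1) : (j <= i)%N -> tplus (@young_A b) (@young_le b) (i, j) S
    = (nat_of_ord i == j + L j.+1)%N && ((L j.+1).+1 < L j)%N.
  move=> ji; rewrite /tplus -sE sL' // -leqNgt; apply/andP/andP => -[h1 h2].
    have iL : nat_of_ord i = (j + L j.+1)%N.
      apply/eqP; rewrite eqn_leq andbC; apply/andP; split; first by lia.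
      rewrite leqNgt; apply/negP => h3.
      have ib : (j + L j.+1 < b.+1)%N by apply: ltn_trans h3 _.
      move/forall_inP/(_ (Ordinal ib, j)): h2; rewrite inE -sE /= leq_addr => /(_ isT).
      rewrite sL ltnn /young_le /= leqnn (ltnW h3) /= => /eqP[].
      by move/(congr1 (@nat_of_ord _)) => /= iE; lia.
    split; first exact/eqP.
    case: (posnP j) => [j0|j0]; first by have := ltn_ord i; rewrite j0 L0; rewrite j0 in iL; lia.
    have jb : (j.-1 < b.+1)%N by have := ltn_ord j; lia.
    rewrite ltnNge; apply/negP => h3; move/forall_inP/(_ (i, Ordinal jb)): h2.
    have ji' : (j.-1 <= i)%N by lia.
    rewrite inE -sE /= ji' => /(_ isT).
    have {1}-> : s i j.-1 = false by rewrite sL' // prednK //; apply/negbTE; lia.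
    rewrite /young_le /= leqnn leq_pred /= => /eqP[].
    by move/(congr1 (@nat_of_ord _)) => /=; lia.
  split; first by lia.
  apply/forall_inP => -[i' j']; rewrite inE -sE /= => ji'; rewrite sL' // -leqNgt /young_le /=.
  apply/implyP => h3; apply/implyP => /andP[h4 h5].
  have [jj|jj] := eqVneq (nat_of_ord j') (nat_of_ord j).
    apply/eqP; congr (_, _); apply/val_inj => //=.
    by rewrite jj in h3; lia.
  have : (j' < j)%N by lia.
  case jk: (nat_of_ord j) h1 h2 => [//|k] /eqP h1 h2; rewrite ltnS => h6.
  have ski : s i k by rewrite sL'; lia.
  by have := sd _ _ _ _ ski ji' h4 h6; rewrite sL'; lia.
(* A row of length 1 is followed by an empty row: its diagonal box is removable although the strict
   gap fails, whence the extra disjunct. *)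
have tmE (i j : 'I_b.+1) : (j <= i)%N -> tminus (@young_le b) (i, j) S
    = (nat_of_ord i == j + (L j.+1).-1)%N &&
      ((0 < L j.+1) && (((L j.+2).+1 < L j.+1) || (L j.+1 == 1)))%N.
  move=> ji; rewrite /tminus -sE sL' //; apply/andP/andP => -[h1 h2].
    have iL : (i - j).+1 = L j.+1 :> nat.
      apply/eqP; rewrite eqn_leq h1 /= leqNgt; apply/negP => h3.
      have ib : (i.+1 < b.+1)%N by have := Lb j; lia.
      move/forall_inP/(_ (Ordinal ib, j)): h2; rewrite -sE /= sL'; last by lia.
      rewrite /young_le /= leqnn leqnSn /= => /(_ ltac:(lia))/eqP[].
      by move/(congr1 (@nat_of_ord _)) => /=; lia.
    split; first by lia.
    rewrite -iL eqSS /=; have [ij|ij] := eqVneq (i - j)%N 0%N; first by rewrite orbT.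
    rewrite orbF ltnS ltnNge; apply/negP => h3.
    have jb : (j.+1 < b.+1)%N by have := ltn_ord i; lia.
    move/forall_inP/(_ (i, Ordinal jb)): h2; rewrite -sE /= sL'; last by lia.
    rewrite /young_le /= leqnn leqnSn /= => /(_ ltac:(lia))/eqP[].
    by move/(congr1 (@nat_of_ord _)) => /=; lia.
  split; first by lia.
  apply/forall_inP => -[i' j']; rewrite -sE => h3; apply/implyP; rewrite /young_le /=.
  have [ji' _] := sb _ _ h3; move=> /andP[h4 h5].
  have [jj|jj] := eqVneq (nat_of_ord j') (nat_of_ord j).
    apply/eqP; congr (_, _); apply/val_inj => //=.
    by move: h3; rewrite sL' // jj; lia.
  have h6 : (j < j')%N by lia.
  have h7 : s i' j by apply: sd h3 _ _ _; lia.
  have [ii|ii] := eqVneq (nat_of_ord i') (nat_of_ord i).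
    have : s i' j.+1 by apply: sd h3 _ _ _; lia.
    by rewrite sL'; have := Ldec j.+1; lia.
  by move: h7; rewrite sL'; lia.
pose N j : R := (1 - c j (L j.+1).-1) *
  ((0 < L j.+1) && (((L j.+2).+1 < L j.+1) || (L j.+1 == 1)))%N%:R.
(* The removable box of the previous row is paired with the addable box of the current one: both
   depend on the gap between [L k] and [L k.+1]. *)
pose N' k := if k is j.+1 then N j else 0.
pose Pl j : R := c j (L j.+1) * ((L j.+1).+1 < L j)%N%:R.
(* The potential whose differences are these paired contributions; its initial value at
   [L 0 = b + 2] is the claimed constant. *)
pose phi k (l : nat) : R := if l == 0%N then 0 else (2 * l%:R + 2 * k%:R - b%:R - 2) / 4.
have step n : Pl n + N' n = phi n (L n) - phi n.+1 (L n.+1).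
  have Ld := Ldec n; rewrite /Pl; case: n Ld => [|n] /=.
    rewrite L0 addr0 /phi /c => h; case: eqP => [->|l0].
      by rewrite ltnS ltn0Sn /= -!natr1; field.
    have [lb|lb] := ltnP (L 1%N) b.+1.
      by rewrite ltnS lb -!natr1 /=; field.
    have -> : L 1%N = b.+1 by have := Lb 0%N; lia.
    by rewrite ltnn -!natr1 /=; field.
  rewrite /N /phi /c; case l1E: (L n.+1) => [|l1]; case l2E: (L n.+2) => [|l2] //= h.
  - by rewrite !mulr0n; ring.
  - case: l1 {l1E} h => [|l1] _; rewrite /= ?mulr0n ?mulr1n -!natr1; by field.
  - move: h; rewrite orbF !ltnS => h.
    have [lb|lb] := ltnP l2.+1 l1.
      have -> : (l1 == 0%N) = false by lia.
      by rewrite /= ?mulr1n -!natr1; field.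
    have -> : l1 = l2.+1 by lia.
    by rewrite /= ?mulr0n ?mulr1n -!natr1; field.
have total n : \sum_(j < n) (Pl j + N j) = phi 0%N (L 0%N) - phi n (L n) + N' n.
  elim: n => [|n IH]; first by rewrite big_ord0 /=; ring.
  rewrite big_ord_recr /= IH -[Pl n](addrK (N' n)) step; ring.
transitivity (\sum_(j < b.+1) (Pl j + N j)).
  pose g (i j : 'I_b.+1) :=
    c j (i - j)%N * (tplus (@young_A b) (@young_le b) (i, j) S)%:R
    + (1 - c j (i - j)%N) * (tminus (@young_le b) (i, j) S)%:R.
  rewrite (eq_bigr (fun u => g u.1 u.2)) => [|[i j] _ //].
  rewrite (eq_bigl (fun u : 'I_b.+1 * 'I_b.+1 => true && (u.2 <= u.1)%N)); last first.
    by move=> u; rewrite inE.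
  rewrite -(pair_big_dep xpredT (fun i j : 'I_b.+1 => (j <= i)%N) g).
  rewrite (exchange_big_dep xpredT) //=; apply: eq_bigr => j _; rewrite big_split /=; congr (_ + _).
    under eq_bigr => i ji do rewrite tpE //.
    rewrite (@sum_ord_pick_cond _ _ _ _ (fun i => (j <= i)%N) (fun i => c j (i - j)%N)).
      by rewrite addKn.
    move=> h; rewrite leq_addr andbT.
    move: h; case: (nat_of_ord j) => [|k]; first by rewrite L0; lia.
    by have := Lb k; lia.
  under eq_bigr => i ji do rewrite tmE //.
  rewrite (@sum_ord_pick_cond _ _ _ _ (fun i => (j <= i)%N) (fun i => 1 - c j (i - j)%N)).
    by rewrite addKn.
  by move=> h; rewrite leq_addr andbT; have := Lb j; lia.
(* The last row has at most one box; if it has one, its removal term equals the final value of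
   [phi]. *)
rewrite total L0 /phi /N' /N /c /=.
have := Lb b; case: (L b.+1) => [|[|l]] h; rewrite /= -?natr1.
- by rewrite mulr0n; field.
- by rewrite ?orbT ?mulr1n; field.
- by exfalso; lia.
Qed.

(** The numbering is a linear extension in which only x_1 and y_1, at [a] and [a.+1], are
    incomparable. *)
Lemma Paa_leE (a : nat) (i j : 'I_(a.*2.+2)) : (1 <= a)%N ->
  Paa_le i j = (i == j) || ((i < j) && ~~ ((i == a :> nat) && (j == a.+1 :> nat)))%N.
Proof.
move=> a1; apply/idP/idP.
  case/connectP => p; elim: p i => [|k p IH] i /=; first by move=> _ ->; rewrite eqxx.
  case/andP => ik kp jE; have := IH _ kp jE; move: ik; rewrite /Paa_cov /=.
  by rewrite -!(inj_eq val_inj) /=; lia.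
case/orP => [/eqP->|]; first exact: connect0.
have [n] := ubnP (nat_of_ord j); elim: n j => // n IH j.
rewrite ltnS => jn /andP[ij ija].
have [k [ik kj kcov]] : exists k : 'I_(a.*2.+2),
    [/\ (i == k) || ((i < k) && ~~ ((i == a :> nat) && (k == a.+1 :> nat)))%N,
        (k < j)%N & Paa_cov k j].
  have jb := ltn_ord j.
  (* An element covered by [j] and still above [i]: usually [j.-1], but w_a below y_1, and x_1 below
     z_1 when starting from x_1. *)
  pose m := if (nat_of_ord j == a.+1) || ((nat_of_ord j == a.+2) && (nat_of_ord i == a))
            then j.-2 else j.-1.
  have mb : (m < a.*2.+2)%N by rewrite /m; case: ifP; lia.
  exists (Ordinal mb); rewrite /Paa_cov -(inj_eq val_inj) /= /m.
  by case: ifP => h; split; lia.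
case/orP: ik => [/eqP->|ik]; first exact: connect1.
apply: connect_trans (connect1 kcov); apply: IH ik; exact: leq_trans kj jn.
Qed.

(** The coefficients are those of the vector weight in type D_{a+2}, of norm 1. All ideals are
    initial segments of the numbering, except the one that contains y_1 but not x_1. *)
Lemma Paa_certified (R : realFieldType) (a : nat) : (1 <= a)%N ->
  toggle_certified R (@Paa_A a) (@Paa_le a).
Proof.
move=> a1; pose c (i : nat) : R := if (i < a)%N then 1 else if (i < a.+2)%N then 1 / 2 else 0.
exists (fun u : 'I_(a.*2.+2) => c u), 1 => S; rewrite inE => /andP[_ /forall_inP Sd].
have {}Sd (u v : 'I_(a.*2.+2)) : u \in S -> (v < u)%N ->
    ~~ ((v == a :> nat) && (u == a.+1 :> nat)) -> v \in S.
  move=> uS h1 h2; move/forall_inP/(_ v): (Sd _ uS); rewrite inE Paa_leE // h1 h2 orbT.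
  by move/(_ isT).
pose s (i : nat) := [exists u in S, u == i :> nat].
have sE (i : 'I_(a.*2.+2)) : (i \in S) = s i.
  apply/idP/exists_inP => [iS|[u uS /eqP/val_inj <- //]].
  by exists i => //=; rewrite !eqxx.
have sb i : s i -> (i < a.*2.+2)%N by case/exists_inP => u uS /eqP<-.
have sd i j : s i -> (j < i)%N -> ~~ ((j == a) && (i == a.+1)) -> s j.
  move=> si ji jia; have ib := sb _ si; have jb : (j < a.*2.+2)%N by lia.
  rewrite -(sE (Ordinal jb)); apply: (Sd (Ordinal ib)) => //; by rewrite sE.
have tpE (i : 'I_(a.*2.+2)) (Q : bool) :
    (Q <-> ~~ s i /\ forall j, (j < i)%N -> ~~ ((j == a) && (nat_of_ord i == a.+1)) -> s j) ->
    tplus (@Paa_A a) (@Paa_le a) i S = Q.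
  move=> Qi; rewrite /tplus sE; apply/andP/idP => [[h1 /forall_inP h2]|/Qi[h1 h2]].
    apply/Qi; split=> // j ji jia; have jb : (j < a.*2.+2)%N by have := ltn_ord i; lia.
    have := h2 (Ordinal jb); rewrite inE sE /= Paa_leE //= ji jia orbT -(inj_eq val_inj) /=.
    by move/(_ isT); case: (s j) => //=; lia.
  split=> //; apply/forall_inP => v _; rewrite sE Paa_leE //; apply/implyP => sv.
  apply/implyP => /orP[//|/andP[h3 h4]]; by rewrite h2 in sv.
have tmE (i : 'I_(a.*2.+2)) (Q : bool) :
    (Q <-> s i /\ forall j, (i < j)%N -> ~~ ((nat_of_ord i == a) && (j == a.+1)) -> ~~ s j) ->
    tminus (@Paa_le a) i S = Q.
  move=> Qi; rewrite /tminus sE; apply/andP/idP => [[h1 /forall_inP h2]|/Qi[h1 h2]].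
    apply/Qi; split=> // j ij ija; apply/negP => sj; have jb := sb _ sj.
    have := h2 (Ordinal jb); rewrite sE /= Paa_leE //= ij ija orbT -(inj_eq val_inj) /= sj.
    by move/(_ isT); lia.
  split=> //; apply/forall_inP => v; rewrite sE Paa_leE // => sv.
  apply/implyP => /orP[/eqP->//|/andP[h3 h4]]; by rewrite (negbTE (h2 _ h3 h4)) in sv.
(* In every case the total 1 comes from a single element, or in halves from x_1 and y_1. *)
have sumE (f : nat -> R) : \sum_(i < a.*2.+2) f i = 1 -> (forall i : 'I_(a.*2.+2),
    c i * (tplus (@Paa_A a) (@Paa_le a) i S)%:R + (1 - c i) * (tminus (@Paa_le a) i S)%:R = f i) ->
    \sum_(u in Paa_A a) (c u * (tplus (@Paa_A a) (@Paa_le a) u S)%:R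
      + (1 - c u) * (tminus (@Paa_le a) u S)%:R) = 1.
  move=> <- fE; rewrite (eq_bigl xpredT) => [|u]; last by rewrite inE.
  by apply: eq_bigr => i _; exact: fE.
pose unit_at l (i : nat) : R := (i == l)%:R.
pose halves (i : nat) : R := 1 / 2 * unit_at a i + 1 / 2 * unit_at a.+1 i.
have one l : (l < a.*2.+2)%N -> \sum_(i < a.*2.+2) unit_at l i = 1.
  move=> lb; rewrite -[RHS](mulr1 1) -(@sum_ord_pick R a.*2.+2 l true (fun=> 1)) //.
  by apply: eq_bigr => i _; rewrite andbT mul1r.
have half : \sum_(i < a.*2.+2) halves i = 1.
  by rewrite big_split -!mulr_sumr /= !one; [field | lia | lia].
(* The exceptional ideal: x_1 is addable and y_1 removable, each for one half. *)
have [sa|sa] := boolP (s a.+1 && ~~ s a).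
  case/andP: sa => sa1 sa.
  have sS k : s k = (k < a)%N || (k == a.+1).
    have [->|ka1] := eqVneq k a.+1; first by rewrite sa1 orbT.
    have [ka|ka] := ltnP k a; first by apply: sd sa1 _ _; lia.
    apply/negbTE; apply: contra sa => sk.
    by have [<- //|ka'] := eqVneq k a; apply: sd sk _ _; lia.
  apply: (sumE _ half) => i; rewrite /halves /unit_at.
  rewrite (tpE i (nat_of_ord i == a)); last first.
    split=> [/eqP->|[]]; first by split=> [//|j ja _]; rewrite sS ja.
    rewrite sS => h1 h2; have := h2 a; rewrite (negbTE sa); lia.
  rewrite (tmE i (nat_of_ord i == a.+1)); last first.
    split=> [/eqP->|[]]; first by split=> [//|j ja _]; rewrite sS; lia.
    rewrite sS => h1 h2; have := h2 a.+1; rewrite sa1; lia.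
  have [->|ia] := eqVneq (nat_of_ord i) a.
    rewrite /c ltnn leqnSn (_ : (a == a.+1) = false) /=; last by lia.
    by field.
  have [->|ia1] := eqVneq (nat_of_ord i) a.+1; last by rewrite /=; ring.
  rewrite /c ltnSn (_ : (a.+1 < a)%N = false) /=; last by lia.
  by field.
have sS k : s k = (k < segment_length s a.*2.+2)%N.
  apply: segment_lengthP k => // j i; rewrite leq_eqVlt => /orP[/eqP->//|ji si].
  case h: ((j == a) && (i == a.+1)); last by apply: sd si ji _; rewrite h.
  by case/andP: h => /eqP ja /eqP ia; subst i j; move: sa; rewrite si /= negbK.
set n := segment_length s a.*2.+2 in sS.
have nb : (n <= a.*2.+2)%N := segment_length_le _ _.
have tpn (i : 'I_(a.*2.+2)) : tplus (@Paa_A a) (@Paa_le a) i S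
    = (nat_of_ord i == n) || ((n == a) && (nat_of_ord i == a.+1)).
  apply: tpE; rewrite sS -leqNgt; split=> [h|[h1 h2]].
    by split=> [|j ji jia]; rewrite ?sS; lia.
  have := h2 n; rewrite sS ltnn; have := h2 n.+1; rewrite sS; lia.
have tmn (i : 'I_(a.*2.+2)) : tminus (@Paa_le a) i S
    = (i.+1 == n) || ((n == a.+2) && (nat_of_ord i == a)).
  apply: tmE; rewrite sS; split=> [h|[h1 h2]].
    by split=> [|j ji jia]; rewrite ?sS; lia.
  have := h2 n.-1; rewrite sS; have := h2 n.-2; rewrite sS; lia.
(* Only w's can be toggled: the addable one counts 1, a removable one 0. *)
have [na|na] := ltnP n a.
  have nb' : (n < a.*2.+2)%N by lia.
  apply: (sumE _ (one n nb')) => i; rewrite /unit_at tpn tmn /c.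
  have [->|ni] := eqVneq (nat_of_ord i) n; first by rewrite na /=; ring.
  have -> : (n == a) = false by lia.
  have -> : (n == a.+2) = false by lia.
  rewrite /= orbF; case: eqP => [ni1|_]; last by rewrite /=; ring.
  have -> : (i < a)%N by lia.
  by rewrite /=; ring.
(* Each of x_1 and y_1 is addable or removable, counting one half either way; a removable w_a or an
   addable z_1 counts 0. *)
have [na2|na2] := leqP n a.+2.
  apply: (sumE _ half) => i; rewrite /halves /unit_at tpn tmn /c.
  have nE : n = a \/ n = a.+1 \/ n = a.+2 by lia.
  have [ia|ia] := ltnP i a.
    have -> : (nat_of_ord i == a) = false by lia.
    have -> : (nat_of_ord i == a.+1) = false by lia.
    have -> : (nat_of_ord i == n) = false by lia.
    rewrite !andbF /=; ring.
  have [->|ia1] := eqVneq (nat_of_ord i) a.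
    rewrite (_ : (a == n) || _ = (n == a)); last by lia.
    rewrite (_ : (a.+1 == n) || _ = (n != a)); last by lia.
    rewrite ltnW // (_ : (a == a.+1) = false); last by lia.
    by case: eqP => _; rewrite /=; field.
  have [->|ia2] := eqVneq (nat_of_ord i) a.+1.
    rewrite (_ : (a.+1 == n) || _ = (n != a.+2)); last by lia.
    rewrite (_ : (a.+2 == n) || _ = (n == a.+2)); last by lia.
    rewrite ltnSn.
    by case: eqP => _; rewrite /=; field.
  have -> : (i < a.+2)%N = false by lia.
  rewrite (_ : (i.+1 == n) || _ = false); last by lia.
  rewrite /=; ring.
(* Only z's can be toggled: the removable one, at [n.-1], counts 1, an addable one 0. *)
have nb' : (n.-1 < a.*2.+2)%N by lia.
apply: (sumE _ (one _ nb')) => i; rewrite /unit_at tpn tmn /c.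
have -> : (n == a) = false by lia.
have -> : (n == a.+2) = false by lia.
rewrite (_ : (i.+1 == n) = (nat_of_ord i == n.-1)) ?andFb ?orbF; last by lia.
have [->|ni] := eqVneq (nat_of_ord i) n.
  have -> : (n < a)%N = false by lia.
  have -> : (n < a.+2)%N = false by lia.
  have -> : (n == n.-1) = false by lia.
  rewrite /=; ring.
have [->|ni1] := eqVneq (nat_of_ord i) n.-1; last by rewrite /=; ring.
have -> : (n.-1 < a)%N = false by lia.
have -> : (n.-1 < a.+2)%N = false by lia.
rewrite /=; ring.
Qed.

(** * Exceptional posets, by computation on incidence tables *)

Definition table_rel (t : seq bitseq) : rel nat :=
  fun i j => nth false (nth [::] t i) j.

Definition extends_ideal (t : seq bitseq) (m : nat) (s : bitseq) :=
  all (fun i => (nth false s m && table_rel t i m ==> nth false s i) &&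
                (nth false s i && table_rel t m i ==> nth false s m)) (iota 0 m).

(** Words grow letter by letter and are filtered at each length, which avoids running through all
    binary words. The list is in lexicographic order, which fixes the indexing of the next table. *)
Fixpoint ideal_words (t : seq bitseq) (n : nat) : seq bitseq :=
  if n is m.+1 then
    filter (extends_ideal t m)
      [seq rcons s b | s <- ideal_words t m, b <- [:: false; true]]
  else [:: [::]].

Definition word_ideals (t : seq bitseq) := ideal_words t (size t).

Definition word_le (s s' : bitseq) :=
  all (fun i => nth false s i ==> nth false s' i) (iota 0 (size s)).

Definition Jtable (t : seq bitseq) : seq bitseq :=
  let L := word_ideals t in [seq [seq word_le s s' | s' <- L] | s <- L].


(* [t] is the matrix of [le] on [A] in the enumeration [e] of [A]. *)
Definition is_table (U : finType) (A : {set U}) (le : rel U) (t : seq bitseq) (e : seq U) :=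
  [/\ size e = size t, uniq e, e =i A &
      {in A &, forall x y, le x y = table_rel t (index x e) (index y e)}].

Lemma ideal_wordsS t m : ideal_words t m.+1 = filter (extends_ideal t m)
  [seq rcons s b | s <- ideal_words t m, b <- [:: false; true]].
Proof. by []. Qed.

Lemma ideal_wordsP t n s :
  reflect (size s = n /\ forall i j, (i < n)%N -> (j < n)%N ->
             table_rel t i j -> nth false s j -> nth false s i)
    (s \in ideal_words t n).
Proof.
elim: n s => [|n IH] s.
  by rewrite inE; apply: (iffP eqP) => [-> // | [/size0nil]].
rewrite ideal_wordsS mem_filter; apply: (iffP andP) => [[ext /allpairsP[[s' b] /= [/IH[sz' id'] _ sE]]]|].
  subst s; rewrite size_rcons sz'; split=> // i j.
  rewrite !ltnS => ilt jlt tij; move: ext => /allP ext.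
  move: ilt jlt; rewrite leq_eqVlt => /orP[/eqP i_n|ilt]; rewrite leq_eqVlt => /orP[/eqP j_n|jlt].
  - by subst i j.
  - subst i; move/(_ j): ext; rewrite mem_iota jlt tij => /(_ isT)/andP[_ /implyP h] sj.
    by apply: h; rewrite sj.
  - subst j; move/(_ i): ext; rewrite mem_iota ilt tij => /(_ isT)/andP[/implyP h _] sj.
    by apply: h; rewrite sj.
  - by rewrite !nth_rcons sz' ilt jlt; apply: id'.
case: (lastP s) => [[]// | s' b]; rewrite size_rcons => -[[sz] id]; split.
  apply/allP => i; rewrite mem_iota /= => ilt; apply/andP; split.
    by apply/implyP => /andP[h1 h2]; apply: id h2 h1 => //; apply: ltnW.
  by apply/implyP => /andP[h1 h2]; apply: id h2 h1 => //; apply: ltnW.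
apply/allpairsP; exists (s', b); split=> //=; last by case: b {id}.
apply/IH; split=> // i j ilt jlt tij; have := id i j (ltnW ilt) (ltnW jlt) tij.
by rewrite !nth_rcons sz ilt jlt.
Qed.

Lemma ideal_words_uniq t n : uniq (ideal_words t n).
Proof.
elim: n => [|n IH] //; rewrite ideal_wordsS; apply/filter_uniq/allpairs_uniq => //.
by move=> [s b] [s' b'] _ _ /= /rcons_inj[-> ->].
Qed.

Lemma map_index_iota (T : eqType) (e : seq T) :
  uniq e -> [seq index x e | x <- e] = iota 0 (size e).
Proof.
case: e => // x0 e ue; apply: (@eq_from_nth _ 0%N); rewrite size_map ?size_iota //.
by move=> i ilt; rewrite (nth_map x0) // nth_iota // index_uniq.
Qed.

Lemma index_surj (T : eqType) (e : seq T) i :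
  uniq e -> (i < size e)%N -> exists2 x, x \in e & index x e = i.
Proof.
case: e => // x0 e ue ilt; exists (nth x0 (x0 :: e) i); first exact: mem_nth.
exact: index_uniq.
Qed.

(** * Binary words as subsets, and the table of the lattice of ideals *)

Section Table.
Variables (U : finType) (A : {set U}) (le : rel U) (t : seq bitseq) (e : seq U).
Hypothesis te : is_table A le t e.

Let sz_e : size e = size t. Proof. by case: te. Qed.
Let uniq_e : uniq e. Proof. by case: te. Qed.
Let mem_e : e =i A. Proof. by case: te. Qed.
Let leE : {in A &, forall x y, le x y = table_rel t (index x e) (index y e)}.
Proof. by case: te. Qed.

Definition word_of_set (S : {set U}) : bitseq := [seq x \in S | x <- e].
Definition set_of_word (s : bitseq) : {set U} := [set x in A | nth false s (index x e)].

Lemma nth_word_of_set (S : {set U}) x : x \in A -> nth false (word_of_set S) (index x e) = (x \in S).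
Proof.
rewrite -mem_e => xe; rewrite (nth_map x) ?index_mem // nth_index //.
Qed.

Lemma index_lt x : x \in A -> (index x e < size t)%N.
Proof. by rewrite -mem_e -sz_e index_mem. Qed.

Lemma word_of_setK (S : {set U}) : S \subset A -> set_of_word (word_of_set S) = S.
Proof.
move=> /subsetP SA; apply/setP => x; rewrite inE; have [xA|xA] := boolP (x \in A).
  by rewrite nth_word_of_set.
by apply/esym; apply: contraNF xA; apply: SA.
Qed.

Lemma set_of_wordK s : size s = size t -> word_of_set (set_of_word s) = s.
Proof.
move=> sz; apply: (@eq_from_nth _ false); rewrite size_map sz_e ?sz // => i ilt.
have [x xe <-] := index_surj uniq_e (eq_ind_r (fun n => i < n)%N ilt sz_e).
have xA : x \in A by rewrite -mem_e.
by rewrite nth_word_of_set // inE xA.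
Qed.

Lemma word_of_set_ideal (S : {set U}) : S \in Jset A le -> word_of_set S \in word_ideals t.
Proof.
rewrite inE => /andP[SA /forall_inP Sd]; apply/ideal_wordsP.
split=> [|i j ilt jlt]; first by rewrite size_map.
rewrite -sz_e in ilt jlt.
have [x xe <-] := index_surj uniq_e ilt; have [y ye <-] := index_surj uniq_e jlt.
have xA : x \in A by rewrite -mem_e.
have yA : y \in A by rewrite -mem_e.
rewrite -leE // !nth_word_of_set // => xy yS.
by move/forall_inP/(_ x xA): (Sd y yS); rewrite xy.
Qed.

Lemma set_of_word_ideal s : s \in word_ideals t -> set_of_word s \in Jset A le.
Proof.
move=> /ideal_wordsP[sz id]; rewrite inE; apply/andP; split.
  by apply/subsetP => x; rewrite inE => /andP[].
apply/forall_inP => x; rewrite inE => /andP[xA sx]; apply/forall_inP => y yA.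
apply/implyP; rewrite inE yA leE //= => yx.
by apply: id yx sx; rewrite index_lt.
Qed.

Lemma word_leP s s' : size s = size t ->
  word_le s s' = (set_of_word s \subset set_of_word s').
Proof.
move=> sz; apply/allP/subsetP => [h x | h i].
  rewrite !inE => /andP[xA sx]; rewrite xA /=.
  by move/(_ (index x e)): h; rewrite mem_iota sz index_lt //= sx; apply.
rewrite mem_iota sz -sz_e /= add0n => ilt; have [x xe <-] := index_surj uniq_e ilt.
have xA : x \in A by rewrite -mem_e.
by apply/implyP => sx; move/(_ x): h; rewrite !inE xA sx; apply.
Qed.

(** Allows [J] to be iterated on tables: from the staircase, one application gives P(E_6) and two
    give P(E_7). *)
Lemma is_table_Jset :
  is_table (Jset A le) (fun I J => I \subset J) (Jtable t)
    [seq set_of_word s | s <- word_ideals t].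
Proof.
have sz s : s \in word_ideals t -> size s = size t by case/ideal_wordsP.
have uniqJ : uniq [seq set_of_word s | s <- word_ideals t].
  rewrite map_inj_in_uniq; first exact: ideal_words_uniq.
  by move=> s s' /sz hs /sz hs' h; rewrite -(set_of_wordK hs) h set_of_wordK.
have indexE s : s \in word_ideals t ->
    index (set_of_word s) [seq set_of_word s | s <- word_ideals t]
    = index s (word_ideals t).
  move=> sL; rewrite -[in LHS](nth_index [::] sL) -(nth_map _ set0) ?index_mem //.
  by rewrite index_uniq // size_map index_mem.
split=> //; first by rewrite !size_map.
  move=> S; apply/mapP/idP => [[s sL ->]|SJ]; first exact: set_of_word_ideal.
  exists (word_of_set S); first exact: word_of_set_ideal.
  by rewrite word_of_setK //; move: SJ; rewrite inE => /andP[].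
move=> S S' SJ SJ'.
have -> : S = set_of_word (word_of_set S).
  by rewrite word_of_setK //; move: SJ; rewrite inE => /andP[].
have -> : S' = set_of_word (word_of_set S').
  by rewrite word_of_setK //; move: SJ'; rewrite inE => /andP[].
have wS := word_of_set_ideal SJ; have wS' := word_of_set_ideal SJ'.
rewrite !indexE // -word_leP ?sz // /table_rel /Jtable.
by rewrite (nth_map [::]) ?index_mem // (nth_map [::]) ?index_mem // !nth_index.
Qed.

End Table.

(** * Verification of coefficients on words *)

Definition word_tplus (t : seq bitseq) (s : bitseq) (i : nat) :=
  ~~ nth false s i &&
  all (fun j => ~~ nth false s j ==> table_rel t j i ==> (j == i)) (iota 0 (size t)).

Definition word_tminus (t : seq bitseq) (s : bitseq) (i : nat) :=
  nth false s i &&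
  all (fun j => nth false s j ==> table_rel t i j ==> (j == i)) (iota 0 (size t)).

(** Coefficients and constant are numerators over the common denominator [D], so the check is a
    computation with integers, independent of the field. *)
Definition table_check (t : seq bitseq) (c : seq int) (D K : int) :=
  all (fun s => foldr (fun i x =>
      (if word_tplus t s i then c`_i else 0) +
      (if word_tminus t s i then D - c`_i else 0) + x) 0 (iota 0 (size t)) == K)
    (word_ideals t).

Lemma table_certified (R : realFieldType) (U : finType) (A : {set U}) (le : rel U)
    (t : seq bitseq) (e : seq U) (c : seq int) (D K : int) :
  is_table A le t e -> D != 0 -> table_check t c D K -> toggle_certified R A le.
Proof.
move=> te D0 /allP chk; have [sz ue me leE] := te.
have D0' : (D%:~R : R) != 0 by rewrite intr_eq0.
exists (fun u => (c`_(index u e))%:~R / D%:~R), (K%:~R / D%:~R) => S SJ.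
have SA : S \subset A by move: SJ; rewrite inE => /andP[].
have := chk _ (word_of_set_ideal te SJ); set s := word_of_set e S => /eqP <-.
have nthS x : x \in A -> nth false s (index x e) = (x \in S).
  exact: nth_word_of_set te _ _.
have indexI x y : x \in A -> y \in A -> (index x e == index y e) = (x == y).
  rewrite -!me => xe ye; apply/eqP/eqP => [h|-> //].
  by rewrite -(nth_index x xe) h nth_index.
have tpE u : u \in A -> tplus A le u S = word_tplus t s (index u e).
  move=> uA; rewrite /tplus /word_tplus nthS // -sz; congr (_ && _).
  apply/forall_inP/allP => [h i | h v vA].
    rewrite mem_iota => /= ilt; have [v ve <-] := index_surj ue ilt.
    have vA : v \in A by rewrite -me.
    by rewrite nthS // -leE // indexI //; apply: h.
  move/(_ (index v e)): h; rewrite mem_iota /= index_mem me vA => /(_ isT).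
  by rewrite nthS // -leE // indexI.
have tmE u : u \in A -> tminus le u S = word_tminus t s (index u e).
  move=> uA; rewrite /tminus /word_tminus nthS // -sz; congr (_ && _).
  apply/forall_inP/allP => [h i | h v vS].
    rewrite mem_iota => /= ilt; have [v ve <-] := index_surj ue ilt.
    have vA : v \in A by rewrite -me.
    rewrite nthS // -leE // indexI //; apply/implyP; exact: h.
  have vA : v \in A by apply: (subsetP SA).
  move/(_ (index v e)): h; rewrite mem_iota /= index_mem me vA => /(_ isT).
  by rewrite nthS // -leE // indexI // vS.
pose G i : R := (c`_i)%:~R / D%:~R * (word_tplus t s i)%:R
  + (1 - (c`_i)%:~R / D%:~R) * (word_tminus t s i)%:R.
(* The sum over [A] is reindexed by positions in [e], in the order of the fold. *)
transitivity (\sum_(i <- iota 0 (size t)) G i).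
  rewrite -sz -map_index_iota // big_map [LHS](eq_bigl (mem e)) => [|u]; last exact/esym/me.
  rewrite -big_uniq //= big_seq [RHS]big_seq; apply: eq_bigr => u.
  by rewrite me => uA; rewrite tpE // tmE.
elim: (iota _ _) => [|i r IH] /=; first by rewrite big_nil mul0r.
rewrite big_cons IH !rmorphD /= !mulrDl; congr (_ + _); rewrite /G.
case: word_tplus; case: word_tminus; rewrite ?rmorphB /= ?mulr1 ?mulr0 ?mul0r ?mulrBl ?divff //.
Qed.

(** * The shifted staircase and the two exceptional posets *)

Definition shift_boxes : seq (nat * nat) :=
  [:: (0, 0); (0, 1); (0, 2); (0, 3); (1, 1); (1, 2); (1, 3); (2, 2); (2, 3); (3, 3)]%N.

Definition shift_table : seq bitseq :=
  [seq [seq (p.1 <= q.1)%N && (p.2 <= q.2)%N | q <- shift_boxes] | p <- shift_boxes].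

Lemma shift_is_table : is_table shift_A shift_le shift_table
  [seq (inord p.1, inord p.2) | p <- shift_boxes].
Proof.
(* The table is computed on pairs of natural numbers; [f] and [g] carry it to ordinals. *)
pose f (p : nat * nat) : 'I_4 * 'I_4 := (inord p.1, inord p.2).
pose g (p : 'I_4 * 'I_4) : nat * nat := (nat_of_ord p.1, nat_of_ord p.2).
have fg p : f (g p) = p by case: p => i j; rewrite /f /= !inord_val.
have gf p : p \in shift_boxes -> g (f p) = p.
  move=> ps; have /allP/(_ p ps)/andP[h1 h2] :
    all (fun p => (p.1 < 4)%N && (p.2 < 4)%N) shift_boxes by [].
  by rewrite /g /f /= !inordK // -surjective_pairing.
have memg p : (g p \in shift_boxes) = (p \in shift_A).
  rewrite [RHS]inE; case: p => i j; move: (ltn_ord i) (ltn_ord j); rewrite /g /=.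
  by case: (nat_of_ord i) => [|[|[|[|?]]]] //; case: (nat_of_ord j) => [|[|[|[|?]]]].
have mem : [seq f p | p <- shift_boxes] =i shift_A.
  move=> p; rewrite -memg; apply/mapP/idP => [[q qs ->]|ps]; first by rewrite gf.
  by exists (g p).
have ufs : uniq [seq f p | p <- shift_boxes].
  rewrite map_inj_in_uniq // => p q ps qs h.
  by rewrite -(gf p ps) h gf.
split=> // p q pA qA.
have indexE r : r \in shift_A -> index r [seq f p | p <- shift_boxes] = index (g r) shift_boxes.
  rewrite -memg => rA; rewrite -[in LHS](fg r) -[in LHS](nth_index (0, 0)%N rA).
  rewrite -(nth_map _ (f (0, 0)%N)) ?index_mem //.
  by rewrite index_uniq // size_map index_mem.
rewrite !indexE // /table_rel (nth_map (0, 0)%N) ?index_mem ?memg //.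
by rewrite (nth_map (0, 0)%N) ?index_mem ?memg // !nth_index ?memg.
Qed.

(* The list is [3 c_p], in the lexicographic order of the words coding the ideals. *)
Lemma E6_certified (R : realFieldType) : toggle_certified R E6_A E6_le.
Proof.
apply: (@table_certified _ _ _ _ _ _
  [:: 4; 5; 6; 3; 4; 3; 2; 1; 2; 1; 0; -1; 0; -3; -2; -1] 3 4
  (is_table_Jset shift_is_table)) => [//|].
by vm_compute.
Qed.

(* The list is [2 c_p], in the lexicographic order of the words coding the ideals. *)
Lemma E7_certified (R : realFieldType) : toggle_certified R E7_A E7_le.
Proof.
apply: (@table_certified _ _ _ _ _ _
  [:: 3; 4; 5; 6; 4; 2; 3; 4; 2; 3; 2; 1; 2; 1; 0; 0; 0; 1; 0; -1; -2; -2; -1; -4; -3; -2; -1] 2 3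
  (is_table_Jset (is_table_Jset shift_is_table))) => [//|].
by vm_compute.
Qed.

Theorem theorem6p2 (R : realFieldType) (d : Order.disp_t) (P : finPOrderType d) :
  minuscule P -> tCDE P R.
Proof.
move=> minP; apply: tCDE_of_components => x.
case: (minP x) => [[a [b [a1 _ iso]]] | [[b [_ iso]] | [[a [a1 iso]] | [iso | iso]]]].
- exact: expect_Tminus_component (rect_certified _ _ a1) iso.
- exact: expect_Tminus_component (young_certified _ _) iso.
- exact: expect_Tminus_component (Paa_certified _ a1) iso.
- exact: expect_Tminus_component (E6_certified _) iso.
- exact: expect_Tminus_component (E7_certified _) iso.
Qed.
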